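(* Let $X=\ell_1$ (complex). A typical $T\in(\mathcal{P}_1(X),\mathrm{SOT})$ has a non-trivial invariant subspace.
   Context: $X=\ell_1=\ell_1(\mathbb{Z}_+)$ is equipped with its canonical basis. A vector is positive if all its coordinates are $\ge0$; a bounded operator $T$ on $X$ is positive if it maps positive vectors to positive vectors. $\mathcal{P}_1(X)$ is the set of bounded positive operators with $\|T\|\le1$. A non-trivial invariant subspace of $T$ is a closed subspace $Y$ of $X$ with $Y\ne\{0\}$, $Y\ne X$ and $T(Y)\subseteq Y$. $\mathrm{SOT}$: $T_i\to T$ iff $\|T_ix-Tx\|\to0$ for every $x\in X$. ''A typical $T\in(\mathcal{P}_1(X),\mathrm{SOT})$ has property (P)'' means that the set of $T\in\mathcal{P}_1(X)$ with (P) is comeager, i.e. contains a dense $G_\delta$ subset of $(\mathcal{P}_1(X),\mathrm{SOT})$. *)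

(* Defs.v *)
From HB Require Import structures.
From mathcomp Require Import all_boot all_order all_algebra.
From mathcomp Require Import complex.
From mathcomp Require Import all_classical all_reals all_analysis.
From mathcomp Require Import borel_hierarchy.

Set Implicit Arguments.
Unset Strict Implicit.
Unset Printing Implicit Defensive.

Import Order.TTheory GRing.Theory Num.Theory ComplexField.Normc.
Import numFieldNormedType.Exports.

Local Open Scope classical_set_scope.
Local Open Scope complex_scope.
Local Open Scope ring_scope.

Section ell1.
Variable R : realType.
Implicit Types (x y : nat -> R[i]) (a : R[i]).

Definition esum_abs x : \bar R := (\sum_(0 <= k <oo) (normc (x k))%:E)%E.

Definition ell1_pred : {pred (nat -> R[i])} :=
  mem [set x | (esum_abs x < +oo)%E].

Lemma normc_ge0 (z : R[i]) : 0 <= normc z.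
Proof. by case: z => u v; exact: sqrtr_ge0. Qed.

Lemma normcE (z : R[i]) : `|z| = (normc z)%:C.
Proof. by []. Qed.

Lemma ler_normcD (z w : R[i]) : normc (z + w) <= normc z + normc w.
Proof. by have := ler_normD z w; rewrite !normcE -rmorphD lecR. Qed.

Lemma esum_abs_ge0 x : (0 <= esum_abs x)%E.
Proof. by apply: nneseries_ge0 => k _ _; rewrite lee_fin normc_ge0. Qed.

Lemma esum_absD x y : (esum_abs (x + y)%R <= esum_abs x + esum_abs y)%E.
Proof.
rewrite -nneseriesD => [|k _ _|k _ _]; rewrite ?lee_fin ?normc_ge0//.
apply: lee_nneseries => k _; first by rewrite lee_fin normc_ge0.
by rewrite -EFinD lee_fin ler_normcD.
Qed.

Lemma esum_absZ a x : esum_abs (a *: x)%R = ((normc a)%:E * esum_abs x)%E.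
Proof.
rewrite /esum_abs -nneseriesZl => [|k _]; last by rewrite lee_fin normc_ge0.
by apply: eq_eseriesr => k _; rewrite -EFinM -normcM.
Qed.

Lemma esum_abs0 : esum_abs 0 = 0%E.
Proof. by apply: eseries0 => k _ _; rewrite normc0. Qed.

Lemma ell1_submod_closed : submod_closed ell1_pred.
Proof.
split=> [|a x y]; rewrite ?inE/= ?esum_abs0// => xfin yfin.
rewrite (le_lt_trans (esum_absD _ _))// esum_absZ lte_add_pinfty//.
by rewrite lte_mul_pinfty ?lee_fin ?normc_ge0.
Qed.

HB.instance Definition _ :=
  GRing.isSubmodClosed.Build _ _ ell1_pred ell1_submod_closed.

Record ell1 := Ell1 { coord :> nat -> R[i]; _ : coord \in ell1_pred }.

HB.instance Definition _ := [isSub for coord].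
HB.instance Definition _ := [Choice of ell1 by <:].
HB.instance Definition _ := [SubChoice_isSubLmodule of ell1 by <:].

Definition ell1_norm (x : ell1) : R := fine (esum_abs x).

Lemma ell1_fin (x : ell1) : esum_abs x \is a fin_num.
Proof. by rewrite ge0_fin_numE ?esum_abs_ge0//; case: x => x/=; rewrite inE. Qed.

Lemma ell1_normD (x y : ell1) :
  (ell1_norm (x + y))%:C <= (ell1_norm x)%:C + (ell1_norm y)%:C.
Proof.
rewrite -rmorphD/= lecR -fineD ?ell1_fin//.
by rewrite fine_le ?fin_numD ?ell1_fin// esum_absD.
Qed.

Lemma ell1_normZ a (x : ell1) :
  (ell1_norm (a *: x))%:C = `|a| * (ell1_norm x)%:C.
Proof.
by rewrite normcE -rmorphM/= /ell1_norm esum_absZ fineM ?ell1_fin.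
Qed.

Lemma ell1_norm_eq0 (x : ell1) : (ell1_norm x)%:C = 0 -> x = 0.
Proof.
move=> [/eqP]; rewrite fine_eq0 ?ell1_fin// => /eqP x0.
apply/val_inj/funext => k /=; apply/eq0_normc/eqP.
rewrite eq_le normc_ge0 andbT -lee_fin -[leRHS]x0.
rewrite /esum_abs (nneseriesD1 (n := k))// => [|j _]; last first.
  by rewrite lee_fin normc_ge0.
by rewrite leeDl// nneseries_ge0// => j _ _; rewrite lee_fin normc_ge0.
Qed.

HB.instance Definition _ := @Lmodule_isNormed.Build R[i] ell1
  (fun x : ell1 => (ell1_norm x)%:C) ell1_normD ell1_normZ ell1_norm_eq0.

End ell1.

Section operators.
Variable R : realType.
Implicit Types T : ell1 R -> ell1 R.

Definition bounded_operator T :=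
  linear T /\ exists M : R, forall x, ell1_norm (T x) <= M * ell1_norm x.

(* A supremum in R, hence the usual norm only for a bounded operator: [sup] is 0
   on an unbounded set. *)
Definition operator_norm T : R :=
  sup [set ell1_norm (T x) | x in [set x | ell1_norm x <= 1]].

(* In R[i], [0 <= z] means that z is real and nonnegative. *)
Definition positive_vector (x : ell1 R) := forall k, 0 <= coord x k.

Definition positive_operator T :=
  forall x, positive_vector x -> positive_vector (T x).

(* The ambient type carries the topology of pointwise convergence for the norm
   of l_1, so that the subtype P1 R, as a topological space, is (P_1(X), SOT). *)
Definition P1 : set {ptws ell1 R -> ell1 R} :=
  [set T | [/\ bounded_operator T, positive_operator T & operator_norm T <= 1]].

Lemma P1_cvgE (F : set_system P1) (T : P1) : Filter F ->
  F --> T <-> forall x, (fun S : P1 => \val S x) @ F --> (\val T x : ell1 R).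
Proof.
move=> FF; split=> [FT x|FT].
  have vFT : \val @ F --> (\val T : {ptws ell1 R -> ell1 R}).
    by apply: cvg_trans; [exact: cvg_app FT|exact: initial_continuous].
  exact: ((@pointwise_cvgP (ell1 R) (ell1 R) _ (\val T) _).1 vFT x).
have vFT : {ptws, (fun S : P1 => \val S : ell1 R -> ell1 R) @ F --> \val T}.
  exact: ((@pointwise_cvgP (ell1 R) (ell1 R) _ (\val T) _).2 FT).
move=> A /= [_ [[B Bop <-] BT sBA]].
have /vFT FB : nbhs (\val T : {ptws ell1 R -> ell1 R}) B.
  by rewrite nbhsE; exists B.
exact: (@filterS _ F FF _ _ sBA FB).
Qed.

Definition nontrivial_invariant_subspace T (Y : set (ell1 R)) :=
  [/\ submod_closed (mem Y), closed Y, Y <> [set 0], Y <> setT &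
      T @` Y `<=` Y].

Definition has_nontrivial_invariant_subspace T :=
  exists Y, nontrivial_invariant_subspace T Y.

End operators.

Arguments P1 : clear implicits.

Definition comeager (X : topologicalType) (A : set X) :=
  exists2 G : set X, dense G /\ Gdelta G & G `<=` A.

(* Main.v *)
Require Import Defs.
From HB Require Import structures.
From mathcomp Require Import all_boot all_order all_algebra complex.
From mathcomp Require Import all_classical all_reals all_analysis.
From mathcomp Require Import borel_hierarchy lra.

(** A typical positive contraction [T] of l_1 has a kernel different from 0 and
    from the whole space, and the kernel of a bounded operator is a closed
    invariant subspace.

    The kernel is produced by two kinds of conditions, each open for the strong
    operator topology: for every [j], some [x] of norm at most 1 satisfies
    [|T x - e_j| < 1/2]; and some [v] satisfies [4 |T v| < |v|].
    Their conjunction is a G_delta set, [almost_quotient].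

    An operator satisfying them is not injective. By the first kind of condition
    and the l_1 norm, every [y] has an approximate preimage of norm at most [|y|]
    with error at most [3/4 |y|] ([approximate_preimage]); iterating and summing,
    which uses that l_1 is complete ([ell1_limit_rate]), every [y] has an exact
    preimage of norm at most [4 |y|] ([exact_preimage]). Applied to
    [y = T v], this gives some [w] with [T w = T v] and [|w| < |v|], so that
    [v - w] is a nonzero vector of the kernel ([kernel_neq0]). The operator is
    not 0 either, since it is onto.

    The set is dense without any appeal to Baire's theorem, because explicit
    members of it converge to any given [T]: let [T_n] agree with [T] on the first
    [n] basis vectors, kill [e_n], and map [e_(n+1+j)] to [e_j]
    ([shift_approx]). On l_1 an operator is a positive contraction as soon as it
    maps the basis to positive vectors of norm at most 1, so [T_n] is one again;
    and [|T x - T_n x|] is at most twice the norm of the tail of [x] from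
    [n] on. *)

Set Implicit Arguments.
Unset Strict Implicit.
Unset Printing Implicit Defensive.

Import Order.TTheory GRing.Theory Num.Theory ComplexField.Normc.
Import numFieldNormedType.Exports.

Local Open Scope classical_set_scope.
Local Open Scope complex_scope.
Local Open Scope ring_scope.

(** * Norm and partial sums *)

Section norm.
Variable R : realType.
Implicit Types (x y : ell1 R) (a : R[i]).

Lemma ell1_norm_triangle x y : ell1_norm (x + y) <= ell1_norm x + ell1_norm y.
Proof. by have := ell1_normD x y; rewrite -rmorphD lecR. Qed.

Lemma ell1_norm_scale a x : ell1_norm (a *: x) = normc a * ell1_norm x.
Proof. by rewrite /ell1_norm esum_absZ fineM ?ell1_fin. Qed.

Lemma ell1_normN x : ell1_norm (- x) = ell1_norm x.
Proof. by have [] := normrN x. Qed.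

Lemma ell1_norm0 : ell1_norm (0 : ell1 R) = 0.
Proof. by rewrite /ell1_norm esum_abs0. Qed.

Lemma ell1_norm_ge0 x : 0 <= ell1_norm x.
Proof. by rewrite fine_ge0 ?esum_abs_ge0. Qed.

Lemma ell1_norm0_eq0 x : ell1_norm x = 0 -> x = 0.
Proof. by move=> x0; apply: ell1_norm_eq0; rewrite x0. Qed.

Lemma ell1_norm_gt0 x : x != 0 -> 0 < ell1_norm x.
Proof.
move=> x0; rewrite lt_neqAle ell1_norm_ge0 andbT eq_sym.
by apply: contra_neq x0; exact: ell1_norm0_eq0.
Qed.

(** This lemma and [ell1_norm_le] say together that the norm is the supremum of
    the real partial sums, which reduces norm estimates to finite sums. *)
Lemma partial_sum_le_norm x n :
  \sum_(0 <= k < n) normc (x k) <= ell1_norm x.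
Proof.
rewrite -lee_fin fineK ?ell1_fin// -sumEFin.
by apply: nneseries_lim_ge => k _ _; rewrite lee_fin normc_ge0.
Qed.

Lemma esum_abs_le (u : nat -> R[i]) (c : R) :
  (forall n, \sum_(0 <= k < n) normc (u k) <= c) -> (esum_abs u <= c%:E)%E.
Proof.
move=> uc; apply: lime_le.
  by apply: is_cvg_nneseries => k _ _; rewrite lee_fin normc_ge0.
by apply: nearW => n; rewrite sumEFin lee_fin.
Qed.

Lemma mem_ell1 (u : nat -> R[i]) (c : R) :
  (forall n, \sum_(0 <= k < n) normc (u k) <= c) -> u \in @ell1_pred R.
Proof.
by move=> uc; rewrite inE/= (le_lt_trans (esum_abs_le uc))// ltry.
Qed.

Lemma ell1_norm_le x (c : R) :
  (forall n, \sum_(0 <= k < n) normc (x k) <= c) -> ell1_norm x <= c.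
Proof. by move=> /esum_abs_le; rewrite -lee_fin fineK ?ell1_fin. Qed.

Lemma normc_coord_le x k : normc (x k) <= ell1_norm x.
Proof.
apply: le_trans (partial_sum_le_norm x k.+1).
by rewrite big_nat_recr//= lerDr sumr_ge0// => i _; exact: normc_ge0.
Qed.

Definition tail x n : R := ell1_norm x - \sum_(0 <= k < n) normc (x k).

Lemma cvg_tail x : tail x n @[n --> \oo] --> (0 : R).
Proof.
rewrite -(subrr (ell1_norm x)); apply: cvgB; first exact: cvg_cst.
have psE : (fun n => \sum_(0 <= k < n) normc (x k)) =
    fine \o (fun n => \sum_(0 <= k < n) (normc (x k))%:E)%E.
  by apply/funext => n /=; rewrite sumEFin.
rewrite psE; apply: fine_cvg; rewrite fineK ?ell1_fin//.
by apply: is_cvg_nneseries => k _ _; rewrite lee_fin normc_ge0.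
Qed.
End norm.

(** * Completeness *)

Section complete.
Variable R : realType.

(** Cauchy sequences are given here with an explicit rate [c], which the limit
    inherits: the bound at index 0 is what later controls the size of the
    solution of an equation. *)
Lemma real_limit_rate (a c : nat -> R) : c n @[n --> \oo] --> (0 : R) ->
  (forall m n, (m <= n)%N -> `|a n - a m| <= c m) ->
  exists l, forall m, `|l - a m| <= c m.
Proof.
move=> c0 ac; have acvg : cvgn a.
  apply/cauchy_cvgP/cauchy_exP => e e0.
  have /cvgrPdist_lt/(_ e e0) [N _ Ne] := c0.
  exists (a N), N => // n /= Nn; rewrite /ball/= distrC.
  apply: le_lt_trans (ac _ _ Nn) _.
  have := Ne N (leqnn N); rewrite sub0r normrN.
  by apply: le_lt_trans; exact: ler_norm.
exists (limn a) => m.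
have dcvg : `|a n - a m| @[n --> \oo] --> `|limn a - a m|.
  by apply: cvg_norm; apply: cvgB => //; exact: cvg_cst.
rewrite -(cvg_lim _ dcvg)//.
apply: limr_le; first by apply/cvg_ex; exists `|limn a - a m|.
by exists m => // n /= mn; exact: ac.
Qed.

Lemma normc_Re (z : R[i]) : `|complex.Re z| <= normc z.
Proof. by case: z => u v /=; rewrite -sqrtr_sqr ler_wsqrtr// lerDl sqr_ge0. Qed.

Lemma normc_Im (z : R[i]) : `|complex.Im z| <= normc z.
Proof. by case: z => u v /=; rewrite -sqrtr_sqr ler_wsqrtr// lerDr sqr_ge0. Qed.

Lemma normc_le_ReIm (z : R[i]) :
  normc z <= `|complex.Re z| + `|complex.Im z|.
Proof.
case: z => u v /=; rewrite -[leRHS]ger0_norm ?addr_ge0// -sqrtr_sqr.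
apply: ler_wsqrtr; rewrite sqrrD !real_normK ?num_real//.
by rewrite -addrA [_ *+ 2 + _]addrC addrA lerDl mulrn_wge0// mulr_ge0.
Qed.

Lemma complex_limit_rate (a : nat -> R[i]) (c : nat -> R) :
  c n @[n --> \oo] --> (0 : R) ->
  (forall m n, (m <= n)%N -> normc (a n - a m) <= c m) ->
  exists l, forall m, normc (l - a m) <= 2 * c m.
Proof.
move=> c0 ac.
have [||l lE] := @real_limit_rate (fun n => complex.Re (a n)) c => //.
  move=> m n mn; apply: le_trans (ac _ _ mn).
  by rewrite -raddfB; exact: normc_Re.
have [||l' l'E] := @real_limit_rate (fun n => complex.Im (a n)) c => //.
  move=> m n mn; apply: le_trans (ac _ _ mn).
  by rewrite -raddfB; exact: normc_Im.
exists (l +i* l') => m; apply: le_trans (normc_le_ReIm _) _.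
rewrite mulr2n mulrDl mul1r.
by apply: lerD; rewrite raddfB /=; [exact: lE|exact: l'E].
Qed.

(** The limit is taken coordinatewise. The factor 2 lost on each coordinate by
    working with real and imaginary parts is harmless: on the first [K]
    coordinates, compare with a term of index [n] far beyond [m]; the error is at
    most [K * (2 * c n)], which vanishes as [n] grows while [K] stays fixed. *)
Lemma ell1_limit_rate (s : nat -> ell1 R) (c : nat -> R) :
  c n @[n --> \oo] --> (0 : R) ->
  (forall m n, (m <= n)%N -> ell1_norm (s n - s m) <= c m) ->
  exists x, forall m, ell1_norm (x - s m) <= c m.
Proof.
move=> c0 sc.
have coord_lim k : exists l : R[i], forall m, normc (l - s m k) <= 2 * c m.
  apply: complex_limit_rate => // m n mn.
  exact: le_trans (normc_coord_le (s n - s m) k) (sc _ _ mn).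
have [u uE] := choice coord_lim.
have u_sum m K : \sum_(0 <= k < K) normc (u k - s m k) <= c m.
  have cvg_c : K%:R * (2 * c n) + c m @[n --> \oo] --> c m.
    rewrite -[X in _ --> X](add0r (c m)) -(mulr0 (K%:R * 2)).
    under eq_fun do rewrite mulrA.
    apply: cvgD; last exact: cvg_cst.
    by apply: cvgM => //; exact: cvg_cst.
  rewrite -(cvg_lim _ cvg_c)//.
  apply: limr_ge; first by apply/cvg_ex; exists (c m).
  exists m => // n /= mn.
  apply: le_trans
    (_ : \sum_(0 <= k < K) (2 * c n + normc ((s n - s m) k)) <= _).
    apply: ler_sum => k _.
    have -> : u k - s m k = (u k - s n k) + (s n - s m) k.
      by rewrite /= addrA subrK.
    by apply: le_trans (ler_normcD _ _) _; rewrite lerD2r.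
  rewrite big_split/= sumr_const_nat subn0 -(mulr_natl (2 * c n)) lerD//.
  exact: le_trans (partial_sum_le_norm _ _) (sc _ _ mn).
have u_ell1 : u \in @ell1_pred R.
  apply: (@mem_ell1 _ _ (c 0 + ell1_norm (s 0))) => K.
  apply: le_trans
    (_ : \sum_(0 <= k < K) (normc (u k - s 0 k) + normc (s 0 k)) <= _).
    apply: ler_sum => k _; rewrite -[X in normc X <= _](subrK (s 0 k)).
    exact: ler_normcD.
  by rewrite big_split/= lerD ?partial_sum_le_norm.
by exists (Ell1 u_ell1) => m; apply: ell1_norm_le => K; exact: u_sum.
Qed.
End complete.

(** * Truncation and backward shift *)

Section truncation.
Variable R : realType.
Implicit Types (x y : ell1 R).

Lemma unit_vec_partial_sum j n :
  \sum_(0 <= k < n) normc ((k == j)%:R : R[i]) <= (1 : R).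
Proof.
elim: n => [|n IHn]; first by rewrite big_geq.
rewrite big_nat_recr//=; have [->|nj] := eqVneq n j.
  rewrite normc1 big_nat big1 ?add0r// => k kj.
  by rewrite ltn_eqF ?normc0//; case/andP: kj.
by rewrite normc0 addr0.
Qed.

Definition unit_vec j : ell1 R := Ell1 (mem_ell1 (unit_vec_partial_sum j)).

Lemma unit_vec_norm_le j : ell1_norm (unit_vec j) <= 1.
Proof. by apply: ell1_norm_le => n; exact: unit_vec_partial_sum. Qed.

Lemma unit_vec_neq0 j : unit_vec j != 0.
Proof.
apply/eqP => /(congr1 (fun x : ell1 R => x j)) /= /eqP.
by rewrite eqxx oner_eq0.
Qed.

Definition truncation n x : ell1 R := \sum_(0 <= j < n) x j *: unit_vec j.

Lemma truncation_coord n x k : truncation n x k = if (k < n)%N then x k else 0.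
Proof.
rewrite /truncation; elim: n => [|n IHn]; first by rewrite big_geq.
rewrite big_nat_recr//=.
change (truncation n x k + x n * (k == n)%:R =
  if (k < n.+1)%N then x k else 0).
by rewrite IHn ltnS; case: ltngtP => [|_|->];
  rewrite ?mulr0 ?mulr1 ?addr0 ?add0r.
Qed.

Lemma combination_norm_le (f : nat -> ell1 R) (c : R) n x :
  (forall j, ell1_norm (f j) <= c) ->
  ell1_norm (\sum_(0 <= j < n) x j *: f j) <=
    (\sum_(0 <= j < n) normc (x j)) * c.
Proof.
move=> fc; elim: n => [|n IHn]; first by rewrite !big_geq// ell1_norm0 mul0r.
rewrite !big_nat_recr//= mulrDl; apply: le_trans (ell1_norm_triangle _ _) _.
by rewrite lerD// ell1_norm_scale ler_wpM2l ?normc_ge0.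
Qed.

(** Stated with [tail] so that it adds up with the bound on the backward
    shift. *)
Lemma truncation_norm_le n x :
  ell1_norm (truncation n x) <= ell1_norm x - tail x n.
Proof.
rewrite /tail opprB addrC subrK.
rewrite -[leRHS]mulr1.
by apply: combination_norm_le => j; exact: unit_vec_norm_le.
Qed.

Lemma sum_translate (f : nat -> R) m n :
  \sum_(0 <= k < n) f (m + k)%N = \sum_(m <= k < m + n) f k.
Proof.
rewrite -{2}(add0n m) big_addn addnC addnK.
by apply: eq_bigr => k _; rewrite addnC.
Qed.

Lemma block_le_tail x m n :
  \sum_(0 <= k < n) normc (x (m + k)%N) <= tail x m.
Proof.
rewrite /tail lerBrDr addrC.
rewrite (sum_translate (fun k => normc (x k))).
by rewrite -big_cat_nat ?leq_addr//; exact: partial_sum_le_norm.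
Qed.

Lemma truncation_dist_le n x : ell1_norm (x - truncation n x) <= tail x n.
Proof.
apply: ell1_norm_le => m.
have coordE k : (x - truncation n x) k = if (k < n)%N then 0 else x k.
  rewrite /= -[_ k]/(x k - truncation n x k) truncation_coord.
  by case: ifP; rewrite ?subrr ?subr0.
apply: le_trans (block_le_tail _ n m).
under eq_bigr do rewrite coordE.
apply: le_trans
  (_ : \sum_(0 <= k < n + m) normc (if (k < n)%N then 0 else x k) <= _).
  rewrite addnC [leRHS](@big_cat_nat _ _ _ m)//= ?leq_addr// lerDl.
  by apply: sumr_ge0 => k _; exact: normc_ge0.
rewrite (@big_cat_nat _ _ _ n)//= ?leq_addr//.
rewrite [X in X + _]big_nat big1 ?add0r.
  rewrite -(sum_translate (fun k => normc (if (k < n)%N then 0 else x k))).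
  by apply: ler_sum => k _; rewrite ltnNge leq_addr.
by move=> k kn; case/andP: kn => _ ->; rewrite normc0.
Qed.

Lemma backshift_partial_sum m x n :
  \sum_(0 <= k < n) normc (x (m + k)%N) <= ell1_norm x.
Proof.
apply: le_trans (block_le_tail _ _ _) _.
by rewrite /tail lerBlDr lerDl sumr_ge0// => k _; exact: normc_ge0.
Qed.

Definition backshift m x : ell1 R :=
  Ell1 (mem_ell1 (backshift_partial_sum m x)).

Lemma backshift_norm_le m x : ell1_norm (backshift m x) <= tail x m.
Proof. by apply: ell1_norm_le => n; exact: block_le_tail. Qed.

Lemma tail_nincr x m : tail x m.+1 <= tail x m.
Proof.
by rewrite /tail big_nat_recr//= lerD2l lerN2 lerDl normc_ge0.
Qed.

Lemma truncation_linear n : linear (truncation n).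
Proof.
move=> a x y; rewrite /truncation scaler_sumr -big_split/=.
apply: eq_bigr => k _.
by rewrite scalerA -scalerDl.
Qed.

Lemma backshift_linear m : linear (backshift m).
Proof. by move=> a x y; apply/val_inj/funext. Qed.

End truncation.

(** * Exact solutions from approximate preimages of the basis *)

Section open_mapping.
Variables (R : realType) (T : {linear ell1 R -> ell1 R}).
Hypothesis T_contr : forall x, ell1_norm (T x) <= ell1_norm x.
Variable f : nat -> ell1 R.
Hypothesis f1 : forall j, ell1_norm (f j) <= 1.
Hypothesis Tf : forall j, ell1_norm (T (f j) - unit_vec R j) <= 2^-1.
Implicit Types (x y : ell1 R).

(** Here the geometry of l_1 enters: a finite combination of the [f j] costs no
    more norm than the corresponding combination of basis vectors, and the
    errors, each at most 1/2, add up to at most half the norm of [y]. A further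
    1/4 pays for the truncation of [y]. *)
Lemma approximate_preimage y : exists x,
  ell1_norm x <= ell1_norm y /\ ell1_norm (y - T x) <= 3 / 4 * ell1_norm y.
Proof.
have [->|y0] := eqVneq y 0.
  by exists 0; rewrite linear0 subr0 ell1_norm0 mulr0.
have ny := ell1_norm_gt0 y0.
have q0 : 0 < 4^-1 * ell1_norm y by rewrite mulr_gt0.
have /cvgrPdist_lt/(_ _ q0) [N _ /(_ N (leqnn N)) /=] := cvg_tail y.
rewrite sub0r normrN => /(le_lt_trans (ler_norm _)) tailN.
exists (\sum_(0 <= j < N) y j *: f j); split.
  apply: le_trans (combination_norm_le _ _ f1) _.
  by rewrite mulr1 partial_sum_le_norm.
have -> : y - T (\sum_(0 <= j < N) y j *: f j) =
    (y - truncation N y) - \sum_(0 <= j < N) y j *: (T (f j) - unit_vec R j).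
  rewrite linear_sum -addrA; congr (_ + _).
  rewrite -opprD /truncation -big_split/=.
  by congr (- _); apply: eq_bigr => j _; rewrite linearZ/= scalerBr addrC subrK.
apply: le_trans (ell1_norm_triangle _ _) _; rewrite ell1_normN.
have := truncation_dist_le N y; have := combination_norm_le N y Tf.
have := partial_sum_le_norm y N.
by move: tailN; lra.
Qed.

(** The iteration from the open mapping theorem: solve approximately, then solve
    for the remainder. The remainders decay like (3/4)^n, and the constant 4 is
    the sum of that geometric series. *)
Lemma exact_preimage y :
  exists2 x, T x = y & ell1_norm x <= 4 * ell1_norm y.
Proof.
have [h hP] := choice approximate_preimage.
pose r n := iter n (fun z => z - T (h z)) y.
pose q : R := 3 / 4.
pose s n := \sum_(0 <= i < n) h (r i).
have r_le n : ell1_norm (r n) <= q ^+ n * ell1_norm y.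
  elim: n => [|n IHn]; first by rewrite expr0 mul1r.
  apply: le_trans (hP (r n)).2 _.
  by move: IHn; rewrite exprS /q; lra.
have Ts n : T (s n) = y - r n.
  elim: n => [|n IHn]; first by rewrite /s big_geq// linear0 subrr.
  by rewrite /s big_nat_recr//= linearD/= -/(s n) IHn opprB addrA addrAC.
have q_cvg : q ^+ n @[n --> \oo] --> (0 : R).
  by apply: cvg_expr; rewrite /q ger0_norm; lra.
have qM_cvg a : a * q ^+ n @[n --> \oo] --> (0 : R).
  by rewrite -(mulr0 a); apply: cvgM => //; exact: cvg_cst.
have q_ge0 n : 0 <= q ^+ n by rewrite exprn_ge0// /q; lra.
have s_le m n : (m <= n)%N ->
    ell1_norm (s n - s m) <= 4 * ell1_norm y * q ^+ m.
  (* The difference of powers telescopes, which the target bound does not. *)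
  move=> mn.
  apply: le_trans (_ : 4 * ell1_norm y * (q ^+ m - q ^+ n) <= _); last first.
    by rewrite ler_wpM2l ?mulr_ge0 ?ell1_norm_ge0// gerBl.
  elim: n mn => [|n IHn].
    by rewrite leqn0 => /eqP ->; rewrite !subrr ell1_norm0 mulr0.
  rewrite leq_eqVlt => /orP[/eqP ->|/IHn{}IHn].
    by rewrite !subrr ell1_norm0 mulr0.
  rewrite {1}/s big_nat_recr//= -/(s n) addrAC.
  apply: le_trans (ell1_norm_triangle _ _) _.
  have := (hP (r n)).1; have := r_le n; rewrite exprS /q.
  by move: IHn; rewrite /q; lra.
have [x xE] := ell1_limit_rate (qM_cvg _) s_le.
exists x; last by have := xE 0; rewrite /s big_geq// subr0 expr0 mulr1.
apply/eqP; rewrite -subr_eq0; apply/eqP/ell1_norm0_eq0/eqP.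
rewrite eq_le ell1_norm_ge0 andbT.
rewrite -(cvg_lim _ (qM_cvg (5 * ell1_norm y)))//.
apply: limr_ge; first by apply/cvg_ex; exists 0; exact: qM_cvg.
apply: nearW => n.
have -> : T x - y = T (x - s n) - r n.
  by rewrite linearB/= Ts opprB addrA addrAC addrK.
apply: le_trans (ell1_norm_triangle _ _) _; rewrite ell1_normN.
by have := T_contr (x - s n); have := xE n; have := r_le n; lra.
Qed.

(** If [T] shrinks [v] by more than the constant of [exact_preimage], then [T v]
    has a second preimage, shorter than [v]. *)
Lemma kernel_neq0 v : 4 * ell1_norm (T v) < ell1_norm v ->
  exists2 x, x != 0 & T x = 0.
Proof.
move=> Tv; have [w Tw w_le] := exact_preimage (T v).
exists (v - w); last by rewrite linearB/= Tw subrr.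
by apply: contraTneq (le_lt_trans w_le Tv) => /subr0_eq ->; rewrite ltxx.
Qed.

End open_mapping.

(** * Positive contractions *)

Section positive_contractions.
Variable R : realType.
Implicit Types (x : ell1 R) (T : ell1 R -> ell1 R).

Lemma operator_norm_contraction T : bounded_operator T ->
  operator_norm T <= 1 -> forall x, ell1_norm (T x) <= ell1_norm x.
Proof.
move=> [Tlin [M TM]] T1 x.
have unit_ball y : ell1_norm y <= 1 -> ell1_norm (T y) <= 1.
  move=> y1; apply: le_trans T1; apply: ub_le_sup; last by exists y.
  exists `|M| => _ [z /= z1 <-]; apply: le_trans (TM z) _.
  apply: le_trans (_ : `|M| * ell1_norm z <= _).
    by rewrite ler_wpM2r ?ell1_norm_ge0 ?ler_norm.
  by rewrite ler_piMr.
pose L : {linear ell1 R -> ell1 R} :=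
  HB.pack T (GRing.isLinear.Build _ _ _ _ T Tlin).
have [->|x0] := eqVneq x 0; first by have /= -> := linear0 L.
have nx := ell1_norm_gt0 x0.
have normc_inv : normc ((ell1_norm x)^-1%:C) = (ell1_norm x)^-1.
  by rewrite /= expr0n addr0 sqrtr_sqr ger0_norm ?invr_ge0 ?ell1_norm_ge0.
have := unit_ball ((ell1_norm x)^-1%:C *: x).
have /= -> := linearZ_LR L (ell1_norm x)^-1%:C x.
rewrite !ell1_norm_scale normc_inv mulVf ?gt_eqF//.
by move=> /(_ (lexx _)); rewrite mulrC ler_pdivrMr ?mul1r.
Qed.

Lemma P1_intro T : linear T -> positive_operator T ->
  (forall x, ell1_norm (T x) <= ell1_norm x) -> P1 R T.
Proof.
move=> Tlin Tpos Tle; split=> //.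
  by split=> //; exists 1 => x; rewrite mul1r.
apply: ge_sup; first by exists (ell1_norm (T 0)), 0 => //=; rewrite ell1_norm0.
by move=> _ [x /= x1 <-]; exact: le_trans (Tle x) x1.
Qed.

Lemma kernel_invariant (T : {linear ell1 R -> ell1 R}) u v :
  (forall x, ell1_norm (T x) <= ell1_norm x) ->
  T u <> 0 -> v != 0 -> T v = 0 -> has_nontrivial_invariant_subspace T.
Proof.
move=> Tle Tu v0 Tv; exists [set x | T x = 0]; split.
- split=> [|a x y]; rewrite ?inE/= ?linear0// => Tx Ty.
  by rewrite linearP/= Tx Ty scaler0 addr0.
- have Tcont : continuous T.
    apply/bounded_linear_continuous/linear_boundedP; near=> c => x.
    apply: le_trans (_ : `|x| <= c * `|x|); first by rewrite lecR; exact: Tle.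
    by rewrite ler_peMl//; near: c; exact: nbhs_pinfty_ge.
  have -> : [set x | T x = 0] = T @^-1` [set 0] by [].
  apply: closed_comp => [x _|]; first exact: Tcont.
  exact: accessible_closed_set1 (hausdorff_accessible _) _.
- by move=> /seteqP[/(_ v Tv)/= /eqP]; rewrite (negbTE v0).
- by move=> /seteqP[_ /(_ u I)].
- by move=> _ [x /= Tx <-]; rewrite Tx linear0.
Unshelve. all: by end_near.
Qed.

Section approximation.
Variable T : {linear ell1 R -> ell1 R}.
Hypothesis T_pos : positive_operator T.
Hypothesis T_contr : forall x, ell1_norm (T x) <= ell1_norm x.

(** Shifting by [n.+1] rather than [n] leaves the [n]-th basis vector unused, and
    it falls into the kernel. *)
Definition shift_approx n x : ell1 R :=
  T (truncation n x) + backshift n.+1 x.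

Lemma shift_approx_linear n : linear (shift_approx n).
Proof.
move=> a x y; rewrite /shift_approx truncation_linear backshift_linear linearP.
by rewrite scalerDr addrACA.
Qed.

Lemma shift_approx_pos n : positive_operator (shift_approx n).
Proof.
move=> x x0 k; apply: addr_ge0; last exact: x0.
apply: T_pos => j; rewrite truncation_coord; case: ifP => // _; exact: x0.
Qed.

(** The two summands look at disjoint sets of coordinates of [x]. *)
Lemma shift_approx_contr n x : ell1_norm (shift_approx n x) <= ell1_norm x.
Proof.
apply: le_trans (ell1_norm_triangle _ _) _.
have := T_contr (truncation n x); have := truncation_norm_le n x.
by have := backshift_norm_le n.+1 x; have := tail_nincr x n; lra.
Qed.

Lemma shift_approx_P1 n : P1 R (shift_approx n).
Proof.
apply: P1_intro; first exact: shift_approx_linear.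
  exact: shift_approx_pos.
exact: shift_approx_contr.
Qed.

Lemma shift_approx_dist n x :
  ell1_norm (T x - shift_approx n x) <= 2 * tail x n.
Proof.
rewrite /shift_approx opprD addrA -linearB.
apply: le_trans (ell1_norm_triangle _ _) _; rewrite ell1_normN.
have := T_contr (x - truncation n x); have := truncation_dist_le n x.
by have := backshift_norm_le n.+1 x; have := tail_nincr x n; lra.
Qed.

Lemma shift_approx_surj n j :
  shift_approx n (unit_vec R (n.+1 + j)) = unit_vec R j.
Proof.
rewrite /shift_approx; have -> : truncation n (unit_vec R (n.+1 + j)) = 0.
  apply/val_inj/funext => k /=; rewrite -[LHS]/(truncation _ _ k).
  rewrite truncation_coord; case: ifP => //= kn.
  by rewrite ltn_eqF// (leq_trans kn)// leqW// leq_addr.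
rewrite linear0 add0r; apply/val_inj/funext => k /=.
by rewrite eqn_add2l.
Qed.

Lemma shift_approx_kernel n : shift_approx n (unit_vec R n) = 0.
Proof.
rewrite /shift_approx; have -> : truncation n (unit_vec R n) = 0.
  apply/val_inj/funext => k /=; rewrite -[LHS]/(truncation _ _ k).
  by rewrite truncation_coord; case: ifP => //= kn; rewrite ltn_eqF.
rewrite linear0 add0r; apply/val_inj/funext => k /=.
by rewrite gtn_eqF// addSn ltnS leq_addr.
Qed.

End approximation.
End positive_contractions.

(** * The dense G_delta set *)

Section typical.
Variable R : realType.

Lemma open_ell1_ball (y : ell1 R) (r : R) :
  open [set x : ell1 R | ell1_norm (x - y) < r].
Proof.
have -> : [set x : ell1 R | ell1_norm (x - y) < r] = ball y r%:C.
  by apply/seteqP; split=> x /=; rewrite -ball_normE/= distrC ltcR.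
exact: ball_open.
Qed.

Lemma open_evaluation (x : ell1 R) (A : set (ell1 R)) :
  open A -> open [set S : P1 R | A (\val S x)].
Proof.
move=> Aopen; rewrite openE => S /= AS.
have ev := (@P1_cvgE R (nbhs S) S _).1 (fun B nB => nB) x.
by have /ev : nbhs (\val S x : ell1 R) A by exact: open_nbhs_nbhs.
Qed.

Definition almost_hits (j : nat) : set (P1 R) :=
  \bigcup_(x in [set x : ell1 R | ell1_norm x <= 1])
    [set S : P1 R | ell1_norm (\val S x - unit_vec R j) < 2^-1].

(** The center 0 of the ball is kept so that openness of both families comes from
    [open_ell1_ball]. *)
Definition shrinks : set (P1 R) :=
  \bigcup_(x in [set x : ell1 R | 0 < ell1_norm x])
    [set S : P1 R | ell1_norm (\val S x - 0) < ell1_norm x / 4].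

(** Every condition asks for a vector whose image lies in a given open ball, so
    it is open for pointwise convergence. The constants are such that hitting all
    the balls makes [S] solvable with constant 4, which the last condition turns
    into a failure of injectivity. *)
Definition almost_quotient : set (P1 R) :=
  \bigcap_j (almost_hits j `&` shrinks).

Lemma almost_quotient_Gdelta : Gdelta almost_quotient.
Proof.
exists (fun j => almost_hits j `&` shrinks) => // j.
apply: openI; apply: bigcup_open => x /= x0.
  apply: (@open_evaluation x [set z | ell1_norm (z - unit_vec R j) < 2^-1]).
  exact: open_ell1_ball.
apply: (@open_evaluation x [set z | ell1_norm (z - 0) < ell1_norm x / 4]).
exact: open_ell1_ball.
Qed.

(** Any [S0] is the pointwise limit of its shift approximations, and these lie in
    the set because they satisfy its conditions exactly: every basis vector is
    the image of a basis vector, and some basis vector is killed. *)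
Lemma almost_quotient_dense : dense almost_quotient.
Proof.
move=> O [S0 OS0] Oopen.
have [[S0lin _] S0pos S0norm] := set_valP S0.
have S0bdd : bounded_operator (\val S0) by case: (set_valP S0).
pose T : {linear ell1 R -> ell1 R} :=
  HB.pack (\val S0 : ell1 R -> ell1 R) (GRing.isLinear.Build _ _ _ _ _ S0lin).
have T_contr x : ell1_norm (T x) <= ell1_norm x.
  exact: operator_norm_contraction.
pose S n : P1 R := SigSub (mem_set (shift_approx_P1 (T := T) S0pos T_contr n)).
have S_cvg : S n @[n --> \oo] --> S0.
  apply/P1_cvgE => x.
  apply/(@cvgrPdist_lt _ (ell1 R : normedModType R[i]) _ (nbhs \oo)) => e e0.
  have eR : e = (complex.Re e)%:C by rewrite RRe_real// gtr0_real.
  rewrite eR; have e1 : 0 < complex.Re e / 2 by rewrite divr_gt0// -ltcR -eR.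
  have /cvgrPdist_lt/(_ _ e1) [N _ tailN] := cvg_tail x.
  exists N => // n /= /tailN.
  rewrite sub0r normrN => /(le_lt_trans (ler_norm _)) tailn.
  rewrite ltcR; apply: le_lt_trans (shift_approx_dist T_contr n x) _.
  by move: tailn; lra.
have /S_cvg [N _ /(_ N (leqnn N)) OSN] : nbhs S0 O by exact: open_nbhs_nbhs.
exists (S N); split => // j _; split.
  exists (unit_vec R (N.+1 + j)); first exact: unit_vec_norm_le.
  by rewrite /= shift_approx_surj subrr ell1_norm0 invr_gt0.
have eN := ell1_norm_gt0 (unit_vec_neq0 R N).
exists (unit_vec R N) => //=.
by rewrite shift_approx_kernel subrr ell1_norm0 divr_gt0.
Qed.

Lemma almost_quotient_invariant (S : P1 R) :
  almost_quotient S -> has_nontrivial_invariant_subspace (\val S).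
Proof.
move=> gS.
have [Sbdd _ Snorm] := set_valP S.
pose T : {linear ell1 R -> ell1 R} :=
  HB.pack (\val S : ell1 R -> ell1 R) (GRing.isLinear.Build _ _ _ _ _ Sbdd.1).
have T_contr x : ell1_norm (T x) <= ell1_norm x.
  exact: operator_norm_contraction.
have hits j : exists x : ell1 R,
    ell1_norm x <= 1 /\ ell1_norm (T x - unit_vec R j) <= 2^-1.
  by have [[x /= x1 Sx] _] := gS j I; exists x; split=> //; exact: ltW.
have [f fP] := choice hits.
have f1 j := (fP j).1; have Tf j := (fP j).2.
have [_ [v v0 /= Sv]] := gS 0 I.
have [|w w0 Tw] := @kernel_neq0 R T T_contr f f1 Tf v.
  by move: Sv; rewrite subr0 /=; lra.
have [u Tu _] := exact_preimage T_contr f1 Tf (unit_vec R 0).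
apply: (@kernel_invariant R T u w) => //.
by rewrite Tu; apply/eqP; exact: unit_vec_neq0.
Qed.

End typical.

Theorem corollary4p4 (R : realType) :
  comeager [set T : P1 R | has_nontrivial_invariant_subspace (\val T)].
Proof.
exists (@almost_quotient R); last by move=> S; exact: almost_quotient_invariant.
by split; [exact: almost_quotient_dense|exact: almost_quotient_Gdelta].
Qed.
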